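(* Let $k \geq 2$ be an integer and let $H$ be a $2k$-regular graph. Then there exists a bipartite cubic inflation of $H$ with $2k|V(H)|$ vertices.
   Context: All graphs are finite and simple. A cubic graph is a $3$-regular graph. Let $H$ be a graph and let $G$ be a cubic graph. Then $G$ is called an inflation of $H$ if $G$ contains a $2$-factor $F$ (a spanning $2$-regular subgraph) consisting of chordless cycles such that the graph obtained from $G$ by contracting each cycle of $F$ to a vertex is isomorphic to $H$. *)

(* Defs.v *)
From mathcomp Require Import all_boot.

Set Implicit Arguments.
Unset Strict Implicit.
Unset Printing Implicit Defensive.

Record sgraph := SGraph {
  vertex :> finType;
  adj : rel vertex;
  adj_sym : symmetric adj;
  adj_irrefl : irreflexive adj }.

Definition edge_set (T : finType) (r : rel T) : {set {set T}} :=
  [set [set p.1; p.2] | p : T * T & r p.1 p.2].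

Definition regular (T : finType) (d : nat) (r : rel T) : Prop :=
  forall x : T, #|[set y | r x y]| = d.

Definition cubic (G : sgraph) : Prop := regular 3 (@adj G).

Definition bipartite (G : sgraph) : Prop :=
  exists A : {set G}, forall x y : G, adj x y -> (x \in A) != (y \in A).

(* A spanning subgraph of G is given by its adjacency relation F. *)
Definition two_factor (G : sgraph) (F : rel G) : Prop :=
  [/\ symmetric F, subrel F (@adj G) & regular 2 F].

(* Meant for a 2-factor F: the connected components of a 2-regular simple graph
   are exactly its cycles. Each cycle is represented by its vertex set. *)
Definition cycles (G : sgraph) (F : rel G) : {set {set G}} :=
  equivalence_partition (connect F) [set: G].

(* A chord of the cycle C of F is an edge of G, not in F, between two vertices
   of C. *)
Definition chordless (G : sgraph) (F : rel G) (C : {set G}) : Prop :=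
  forall x y : G, x \in C -> y \in C -> adj x y -> F x y.

(* Contracting every cycle of F gives a multigraph: its vertices are the cycles
   of F and its edges are the edges of G outside F. Nothing is simplified:
   contraction_mult C D counts the parallel edges between C and D, or the loops
   at C if C = D. *)
Definition contraction_vertex (G : sgraph) (F : rel G) : finType :=
  {C : {set G} | C \in cycles F}.

Definition contraction_mult (G : sgraph) (F : rel G)
    (C D : contraction_vertex F) : nat :=
  #|[set e in edge_set (@adj G) :\: edge_set F |
      [exists x in val C, exists y in val D, e == [set x; y]]]|.

(* The boolean adj is read as an edge multiplicity, so the contraction is
   isomorphic to the simple graph H only if it has no loops or parallel edges. *)
Definition contraction_iso (G : sgraph) (F : rel G) (H : sgraph) : Prop :=
  exists phi : contraction_vertex F -> H,
    bijective phi /\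
    forall C D, contraction_mult C D = nat_of_bool (adj (phi C) (phi D)).

Definition inflation (G H : sgraph) : Prop :=
  cubic G /\
  exists F : rel G,
    [/\ two_factor F,
        forall C, C \in cycles F -> chordless F C
      & contraction_iso F H].

(* Main.v *)
(** Number the darts (edge ends) at each vertex of H by 'I_k * bool, so that a
    dart is an element of H * ('I_k * bool).  Pairing (v, (i, b)) with
    (v, (i, ~~ b)) and pairing the two ends of each edge are fixed-point-free
    involutions, whose union is a disjoint union of even cycles; hence the darts
    have a 2-colouring changed by both (this is an Eulerian orientation of H).
    Renumber so that the boolean is this colour.  At each v, the darts are
    arranged into a 2k-cycle by joining (v, (i, true)) to (v, (i, false)) and to
    (v, (i + 1, false)), and the ends of each edge of H are joined: all edges
    change the boolean, so the resulting inflation is bipartite. *)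

Require Import Defs.
From mathcomp Require Import all_boot.

Set Implicit Arguments.
Unset Strict Implicit.
Unset Printing Implicit Defensive.

(** * Colourings changed by two fixed-point-free involutions *)

Section TwoInvolutions.

Variables (T : finType) (p r : T -> T).
Hypotheses (pK : involutive p) (rK : involutive r).
Hypotheses (p_free : forall x, p x != x) (r_free : forall x, r x != x).

Let s x := p (r x).

(** Undoing one [s] at the outer end of [iter n.+2 s x = r x] gives [iter n s (s x) = r (s x)], so
    the induction descends by two. The base cases say that [r] and [p] fix nothing. *)
Lemma iter_comp_involutions_neq n x : iter n s x != r x.
Proof.
elim/ltn_ind: n x => -[|[|n]] IH x.
- by rewrite eq_sym r_free.
- exact: p_free.
- rewrite iterS; apply/eqP => /(congr1 (fun z => r (p z))).
  by rewrite /s pK rK -/s -/(s x) iterSr; apply/eqP/IH.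
Qed.

(* The orbits of x and r x under p \o r are distinct; comparing their
   representatives chooses one of the two. *)
Lemma involutions_flip :
  exists c : T -> bool, (forall x, c (p x) = ~~ c x) /\ (forall x, c (r x) = ~~ c x).
Proof.
have s_inj : injective s by apply: inj_comp; apply: inv_inj.
have rootE x y : fconnect s x y -> froot s x = froot s y.
  by move=> xy; apply/(rootP (fconnect_sym s_inj)).
have root_neq x : froot s x != froot s (r x).
  apply/eqP => /(rootP (fconnect_sym s_inj)) /iter_findex.
  by apply/eqP/iter_comp_involutions_neq.
pose c x := enum_rank (froot s x) < enum_rank (froot s (r x)).
have c_r x : c (r x) = ~~ c x.
  rewrite /c rK -leqNgt [RHS]leq_eqVlt (inj_eq (@ord_inj _)) (inj_eq enum_rank_inj).
  by rewrite eq_sym (negPf (root_neq x)).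
have c_s x : c (s x) = c x.
  rewrite /c -(rootE x (s x)) ?fconnect1 //.
  (* Conjugation by [r] inverts [s]: moving [x] forward moves [r x] backward on its own orbit, so
     both representatives are kept. *)
  rewrite (rootE (r (s x)) (r x)) //.
  have <- : s (r (s x)) = r x by rewrite /s rK pK.
  exact: fconnect1.
exists c; split=> // x.
by rewrite -[in RHS](rK x) c_r negbK -[RHS]c_s /s rK.
Qed.

End TwoInvolutions.

(** * Darts and edge reversal *)

Lemma card_bijection (I T : finType) (A : {set T}) :
  #|A| = #|I| -> exists f : I -> T, injective f /\ forall y, y \in A <-> exists i, f i = y.
Proof.
move=> eqAI; pose f i := enum_val (cast_ord (esym eqAI) (enum_rank i)).
exists f; split; first by move=> i j /enum_val_inj /cast_ord_inj /enum_rank_inj.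
move=> y; split=> [Ay | [i <-]]; last exact: enum_valP.
exists (enum_val (cast_ord eqAI (enum_rank_in Ay y))).
by rewrite /f enum_valK cast_ordK enum_rankK_in.
Qed.

(** The dart [(v, i)] points to the [i]-th neighbour [e v i] of [v]. As each [e v] is injective, a
    dart is determined by its two end vertices, and reversing twice restores both. *)
Lemma edge_reversal (H : sgraph) (I : finType) : regular #|I| (@adj H) ->
  exists r : H * I -> H * I,
    [/\ involutive r,
        forall x y, x.1 = y.1 -> (r x).1 = (r y).1 -> x = y
      & forall v w, adj v w <-> exists x, x.1 = v /\ (r x).1 = w].
Proof.
move=> regH.
have [e e_spec] := fin_all_exists (fun v => card_bijection (regH v)).
have e_inj v : injective (e v) by have [] := e_spec v.
have eP v w : adj v w <-> exists i, e v i = w.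
  by have [_ /(_ w)] := e_spec v; rewrite inE.
have r_ex x : exists y : H * I, y.1 = e x.1 x.2 /\ e y.1 y.2 = x.1.
  have /eP[j ej] : adj (e x.1 x.2) x.1 by rewrite adj_sym; apply/eP; exists x.2.
  by exists (e x.1 x.2, j).
have [r r_spec] := fin_all_exists r_ex.
have r1 x : (r x).1 = e x.1 x.2 by have [] := r_spec x.
have er x : e (r x).1 (r x).2 = x.1 by have [] := r_spec x.
have det x y : x.1 = y.1 -> (r x).1 = (r y).1 -> x = y.
  case: x y => [v i] [w j] /= <-; rewrite !r1 /= => /e_inj <- //.
exists r; split=> //.
- by move=> x; apply: det; rewrite r1 er.
- move=> v w; split=> [/eP[i ei] | [x [<- <-]]].
    by exists (v, i); rewrite r1.
  by apply/eP; exists x.2; rewrite r1.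
Qed.

Lemma alternating_edge_reversal (H : sgraph) (I : finType) :
  regular #|{: I * bool}| (@adj H) ->
  exists r : H * (I * bool) -> H * (I * bool),
    [/\ involutive r,
        forall x, (r x).2.2 = ~~ x.2.2,
        forall x y, x.1 = y.1 -> (r x).1 = (r y).1 -> x = y
      & forall v w, adj v w <-> exists x, x.1 = v /\ (r x).1 = w].
Proof.
move=> /edge_reversal[r [rK r_det rP]].
pose p (x : H * (I * bool)) := (x.1, (x.2.1, ~~ x.2.2)).
have pK : involutive p by case=> v [i b]; rewrite /p /= negbK.
have p_free x : p x != x by case: x => v [i []]; rewrite /p !xpair_eqE !andbF.
have r_free x : r x != x.
  apply/eqP => rx; have : adj x.1 x.1 by apply/rP; exists x; rewrite rx.
  by rewrite adj_irrefl.
have [c [c_p c_r]] := involutions_flip pK rK p_free r_free.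
(* On each pair [(v, (i, true))], [(v, (i, false))] the colour [c] takes both values, so [l] is the
   identity or the swap there. Conjugating [r] by [l] turns the colour into the boolean and keeps
   all vertices. *)
pose l (x : H * (I * bool)) := (x.1, (x.2.1, c x)).
have lK : involutive l.
  have c_true v i : c (v, (i, true)) = ~~ c (v, (i, false)) by rewrite -c_p.
  by case=> v [i []]; rewrite /l /= ?c_true;
    case E: (c (v, (i, false))); rewrite ?c_true E.
exists (fun x => l (r (l x))); split.
- by move=> x; rewrite lK rK lK.
- by move=> x; rewrite /= c_r -[in RHS](lK x).
- by move=> x y /= xy rxy; apply: (inv_inj lK); apply: r_det.
- move=> v w; split=> [/rP[x [<- <-]] | [x [<- <-]]].
    by exists (l x); rewrite lK.
  by apply/rP; exists (l x).
Qed.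

(** * Construction of the inflation *)

Lemma mem_edge_set (T : finType) (r : rel T) x y :
  symmetric r -> ([set x; y] \in edge_set r) = r x y.
Proof.
move=> r_sym; apply/imsetP/idP => [[[a b]] | rxy]; last first.
  by exists (x, y); rewrite ?inE.
rewrite inE /= => rab eq_xy.
have /set2P Ex : x \in [set a; b] by rewrite -eq_xy set21.
have /set2P Ey : y \in [set a; b] by rewrite -eq_xy set22.
have /set2P Ea : a \in [set x; y] by rewrite eq_xy set21.
have /set2P Eb : b \in [set x; y] by rewrite eq_xy set22.
(* If [x] and [y] coincide, equality of the sets forces [a] and [b] to coincide too. *)
case: Ex Ey Ea Eb rab {eq_xy} => -> [] -> // Ea Eb.
- by case: Eb => ->.
- by rewrite r_sym.
- by case: Ea => ->.
Qed.

Lemma ordS_neq k (i : 'I_k) : 2 <= k -> ordS i != i.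
Proof.
move=> hk; rewrite -val_eqE /=.
have [lt_ik | le_ki] := ltnP i.+1 k; first by rewrite modn_small // gtn_eqF.
have -> : i.+1 = k by apply/eqP; rewrite eqn_leq ltn_ord le_ki.
rewrite modnn; apply/eqP => i0.
by move: le_ki; rewrite -i0 leqNgt hk.
Qed.

Section Inflation.

Variables (k : nat) (H : sgraph).
Hypothesis hk : 2 <= k.

Local Notation dart := (H * ('I_k * bool))%type.

Variable r : dart -> dart.
Hypothesis rK : involutive r.
Hypothesis r_flip : forall x, (r x).2.2 = ~~ x.2.2.
Hypothesis r_det : forall x y, x.1 = y.1 -> (r x).1 = (r y).1 -> x = y.
Hypothesis rP : forall v w, adj v w <-> exists x, x.1 = v /\ (r x).1 = w.

Definition same_index (x : dart) : dart := (x.1, (x.2.1, ~~ x.2.2)).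
(** The step goes forward from [true] and backward from [false], which makes it an involution: a
    second perfect matching on the darts at each vertex, closing the first one into a cycle. *)
Definition next_index (x : dart) : dart :=
  (x.1, (if x.2.2 then ordS x.2.1 else ord_pred x.2.1, ~~ x.2.2)).

Lemma same_indexK : involutive same_index.
Proof. by case=> v [i b]; rewrite /same_index /= negbK. Qed.

Lemma next_indexK : involutive next_index.
Proof. by case=> v [i []]; rewrite /next_index /= ?ordSK ?ord_predK. Qed.

Lemma same_next_neq x : same_index x != next_index x.
Proof.
case: x => v [i []]; rewrite /same_index /next_index !xpair_eqE /= !eqxx /= andbT.
  by rewrite eq_sym ordS_neq.
by rewrite -{1}(ord_predK i) ordS_neq.
Qed.

Definition cycle_adj (x y : dart) := (y == same_index x) || (y == next_index x).
Definition inflation_adj (x y : dart) := cycle_adj x y || (y == r x).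

Lemma cycle_adj_fst x y : cycle_adj x y -> y.1 = x.1.
Proof. by case/orP=> /eqP ->. Qed.

Lemma rev_fst_neq x : (r x).1 != x.1.
Proof.
apply/eqP => rx; have : adj x.1 x.1 by apply/rP; exists x.
by rewrite adj_irrefl.
Qed.

Lemma cycle_adj_sym : symmetric cycle_adj.
Proof.
move=> x y; rewrite /cycle_adj -(inv_eq same_indexK) -(inv_eq next_indexK).
by rewrite ![_ == x]eq_sym.
Qed.

Lemma inflation_adj_sym : symmetric inflation_adj.
Proof.
move=> x y; by rewrite /inflation_adj cycle_adj_sym -(inv_eq rK) [_ == x]eq_sym.
Qed.

Lemma inflation_adj_flip x y : inflation_adj x y -> y.2.2 = ~~ x.2.2.
Proof. by case/orP=> [/orP[]|] /eqP ->. Qed.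

Lemma inflation_adj_irrefl : irreflexive inflation_adj.
Proof. by move=> x; apply/negP => /inflation_adj_flip; case: x.2.2. Qed.

Definition inflated : sgraph := SGraph inflation_adj_sym inflation_adj_irrefl.

Lemma inflated_bipartite : bipartite inflated.
Proof.
exists [set x : dart | x.2.2] => x y /inflation_adj_flip.
by rewrite !inE => ->; case: x.2.2.
Qed.

Lemma cycle_nbrs x : [set y | cycle_adj x y] = [set same_index x; next_index x].
Proof. by apply/setP => y; rewrite !inE. Qed.

Lemma inflated_cubic : cubic inflated.
Proof.
move=> x; have -> : [set y : inflated | adj x y] = r x |: [set y | cycle_adj x y].
  by apply/setP => y; rewrite !inE orbC.
rewrite cardsU1 cycle_nbrs cards2 same_next_neq -cycle_nbrs inE.
case: (boolP (cycle_adj _ _)) => // /cycle_adj_fst /eqP.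
by rewrite (negPf (rev_fst_neq x)).
Qed.

Lemma cycle_two_factor : @two_factor inflated cycle_adj.
Proof.
split; first exact: cycle_adj_sym.
- by move=> x y Fxy; apply/orP; left.
- by move=> x; rewrite cycle_nbrs cards2 same_next_neq.
Qed.

(** Cycle edges keep the vertex. Conversely, from a dart with boolean [true], [next_index] followed
    by [same_index] raises the index by one, so index 0 reaches every dart at its vertex. *)
Lemma connect_cycle x y : connect cycle_adj x y = (x.1 == y.1).
Proof.
apply/idP/eqP => [/connectP[s] | ].
  elim: s x => [|z s IH] x /=; first by move=> _ ->.
  by case/andP=> /cycle_adj_fst <- /IH.
have conn_sym := sym_connect_sym cycle_adj_sym.
have same z : connect cycle_adj z (same_index z).
  by apply: connect1; rewrite /cycle_adj eqxx.
have next z : connect cycle_adj z (next_index z).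
  by apply: connect1; rewrite /cycle_adj eqxx orbT.
have k_gt0 : 0 < k by apply: leq_trans hk.
have from0 v n (lt_nk : n < k) :
    connect cycle_adj (v, (Ordinal k_gt0, true)) (v, (Ordinal lt_nk, true)).
  elim: n lt_nk => [|n IH] lt_nk; first by rewrite (bool_irrelevance lt_nk k_gt0).
  apply: connect_trans (IH (ltnW lt_nk)) _.
  apply: connect_trans (next _) _; rewrite /next_index /=.
  have -> : ordS (Ordinal (ltnW lt_nk)) = Ordinal lt_nk.
    by apply: val_inj; rewrite /= modn_small.
  exact: same.
have from0b v i b : connect cycle_adj (v, (Ordinal k_gt0, true)) (v, (i, b)).
  case: i b => n lt_nk [] //; apply: connect_trans (from0 v n lt_nk) _.
  exact: same.
case: x y => [v [i b]] [w [j c]] /= <-.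
by apply: connect_trans (from0b v j c); rewrite conn_sym.
Qed.

(** * Cycles as fibres, and their contraction *)

Definition fibre (v : H) : {set dart} := [set x | x.1 == v].

Lemma fibre_inj : injective fibre.
Proof.
(* [ltnW hk] reads as [0 < k], so this is the dart of index 0, showing that the fibre is
   nonempty. *)
move=> v w /setP /(_ (v, (Ordinal (ltnW hk), true))).
by rewrite !inE eqxx => /esym/eqP.
Qed.

Lemma cyclesP (C : {set dart}) :
  reflect (exists v, C = fibre v) (C \in @cycles inflated cycle_adj).
Proof.
have cycleE x : [set y in [set: dart] | connect cycle_adj x y] = fibre x.1.
  by apply/setP => y; rewrite !inE connect_cycle eq_sym.
apply: (iffP imsetP) => [[x _ ->] | [v ->]]; first by exists x.1.
by exists (v, (Ordinal (ltnW hk), true)); rewrite ?inE ?cycleE.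
Qed.

Lemma contraction_edge x y :
  ([set x; y] \in edge_set inflation_adj :\: edge_set cycle_adj) = (y == r x).
Proof.
rewrite inE (mem_edge_set _ _ cycle_adj_sym) (mem_edge_set _ _ inflation_adj_sym).
rewrite /inflation_adj.
case: eqP => [-> | _]; last by rewrite orbF andNb.
rewrite orbT andbT; apply/negP => /cycle_adj_fst /eqP.
by rewrite (negPf (rev_fst_neq x)).
Qed.

(** The surviving edges are the pairs [[set x; r x]]. By [rP] one runs from [v] to [w] exactly when
    they are adjacent, and [r_det] excludes a second one. *)
Lemma contraction_mult_fibre (C D : @contraction_vertex inflated cycle_adj) v w :
  val C = fibre v -> val D = fibre w -> contraction_mult C D = adj v w.
Proof.
move=> Cv Dw; rewrite /contraction_mult.
set E := [set e in _ | _].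
have EP e : reflect (exists x, [/\ x.1 = v, (r x).1 = w & e = [set x; r x]]) (e \in E).
  rewrite inE; apply: (iffP andP) => [[eE /exists_inP[x]] | [x [xv rxw ->]]].
    rewrite Cv inE => /eqP xv /exists_inP[y].
    rewrite Dw inE => /eqP yw /eqP e_xy.
    by move: eE; rewrite e_xy contraction_edge => /eqP y_r; exists x; rewrite -y_r.
  split; first by rewrite contraction_edge.
  apply/exists_inP; exists x; first by rewrite Cv inE xv.
  by apply/exists_inP; exists (r x); rewrite // Dw inE rxw.
case: (boolP (adj v w)) => [/rP[x [xv rxw]] | /negP no_adj].
  apply/eqP/cards1P; exists [set x; r x]; apply/setP => e; rewrite in_set1.
  apply/EP/eqP => [[y [yv ryw ->]] | ->]; last by exists x.
  by rewrite (@r_det y x) // ?xv ?rxw.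
apply/eqP; rewrite cards_eq0; apply/set0Pn => -[e /EP[x [xv rxw _]]].
by apply/no_adj/rP; exists x.
Qed.

Lemma contraction_inflated : @contraction_iso inflated cycle_adj H.
Proof.
have phi_ex (C : @contraction_vertex inflated cycle_adj) : exists v, val C = fibre v.
  by apply/cyclesP; exact: valP.
have [phi phiE] := fin_all_exists phi_ex.
exists phi; split; last by move=> C D; apply: contraction_mult_fibre.
have fibre_cycle v : fibre v \in @cycles inflated cycle_adj.
  by apply/cyclesP; exists v.
exists (fun v => Sub (fibre v) (fibre_cycle v)) => [C | v].
  by apply: val_inj; rewrite SubK phiE.
by apply: fibre_inj; rewrite -phiE SubK.
Qed.

Lemma inflated_inflation : inflation inflated H.
Proof.
split; first exact: inflated_cubic.
exists cycle_adj; split; [exact: cycle_two_factor | | exact: contraction_inflated].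
(* A chord would be an edge from [x] to [r x] inside one fibre, that is, a loop of [H]. *)
move=> C /cyclesP[v ->] x y; rewrite !inE => /eqP xv /eqP yv /orP[// | /eqP y_r].
by have := rev_fst_neq x; rewrite -y_r xv yv eqxx.
Qed.

End Inflation.

Theorem lemma8 (k : nat) (H : sgraph) (hk : 2 <= k)
    (hH : regular (2 * k) (@adj H)) :
  exists G : sgraph,
    [/\ bipartite G, inflation G H & #|G| = 2 * k * #|H|].
Proof.
have card_idx : #|{: 'I_k * bool}| = 2 * k by rewrite card_prod card_ord card_bool mulnC.
have [|r [rK r_flip r_det rP]] := @alternating_edge_reversal H 'I_k.
  by rewrite card_idx.
exists (inflated rK r_flip); split.
- exact: inflated_bipartite.
- exact: inflated_inflation.
- by rewrite card_prod card_idx mulnC.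
Qed.
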